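(* Let $\mathbb{F}$ be a field. Up to isomorphism there is a unique nilpotent symplectic alternating algebra over $\mathbb{F}$ of dimension $10$ that has an isotropic centre of dimension $5$. This algebra can be described by the nilpotent presentation $$\mathcal{P}_{10}^{(5,1)}:\ (y_{1}y_{2},y_{3})=1,\ \ (y_{1}y_{4},y_{5})=1.$$
   Context: A symplectic alternating algebra (SAA) over a field $\mathbb{F}$ is a finite-dimensional $\mathbb{F}$-vector space $L$ with a non-degenerate alternating bilinear form $(\ ,\ )$ and a bilinear alternating product $L\times L\to L$, $(x,y)\mapsto xy$ (so $xx=0$), such that $(xy,z)=(yz,x)$ for all $x,y,z\in L$. It follows that $(x,y,z)\mapsto (xy,z)$ is an alternating trilinear form. Isomorphisms of SAAs are linear bijections preserving the form and the product. The lower central series is $L^1=L$, $L^{k+1}=L^k L$, where $AB$ denotes the linear span of all products $ab$ with $a\in A,b\in B$. $L$ is nilpotent if $L^{k}=0$ for some $k$. The centre is $Z(L)=\{x\in L: xy=0 \text{ for all } y\in L\}$. A subspace is isotropic if the form vanishes identically on it. A standard basis of a $10$-dimensional SAA is a basis $x_1,y_1,\ldots,x_5,y_5$ with $(x_i,x_j)=(y_i,y_j)=0$ and $(x_i,y_j)=\delta_{ij}$ for all $i,j$. A presentation lists values of triples $(uv,w)$ with $u,v,w$ distinct elements of a standard basis; the convention is that all triple values of basis elements not listed (and not determined from the listed ones by the alternating property) are $0$. Such data determine the product, hence the SAA, uniquely. A nilpotent presentation is one in which the only possibly non-zero listed values are of the form $(x_iy_j,y_k)$ and $(y_iy_j,y_k)$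 with $i<j<k$. *)

(* Defs.v *)
From HB Require Import structures.
From mathcomp Require Import all_boot all_algebra.

Set Implicit Arguments.
Unset Strict Implicit.
Unset Printing Implicit Defensive.

Import GRing.Theory.
Local Open Scope ring_scope.

(* [car] is a [vectType], hence finite-dimensional.  "Alternating" is the
   diagonal condition b(x, x) = 0, which in characteristic 2 is stronger than
   skew-symmetry. *)
Record saa (F : fieldType) := SAA {
  car :> vectType F;
  saa_form : {biscalar car};
  saa_mul : {bilinear car -> car -> car};
  form_alt : forall x, saa_form x x = 0;
  form_nondeg : forall x, (forall y, saa_form x y = 0) -> x = 0;
  mul_alt : forall x, saa_mul x x = 0;
  form_mul : forall x y z, saa_form (saa_mul x y) z = saa_form (saa_mul y z) x
}.

Arguments saa_form {F s}.
Arguments saa_mul {F s}.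

Definition saa_isomorphic (F : fieldType) (L M : saa F) : Prop :=
  exists f : {linear L -> M},
    [/\ bijective f,
        forall x y, saa_form (f x) (f y) = saa_form x y
      & forall x y, f (saa_mul x y) = saa_mul (f x) (f y)].

Section Structure.
Variables (F : fieldType) (L : saa F).
Implicit Types (A B C : {vspace L}) (x y : L) (k : nat).

(* By bilinearity, products of basis vectors span the same subspace as all
   products, see [mulv_subP]. *)
Definition mulv A B : {vspace L} :=
  <<[seq saa_mul a b | a <- vbasis A, b <- vbasis B]>>%VS.

(* Indexed as in L^1 = L, L^(k+1) = L^k L; the value at the index 0, which is
   not part of the series, is L. *)
Definition lcs k : {vspace L} := iter k.-1 (mulv^~ fullv) fullv.

Definition saa_nilpotent : Prop := exists k, lcs k = 0%VS.

(* The kernel of x |-> (y |-> xy), see [centreP]. *)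
Definition centre : {vspace L} :=
  lker (linfun (fun x => linfun (saa_mul x) : 'Hom(L, L))).

Definition isotropic A : Prop := {in A &, forall x y, saa_form x y = 0}.

Lemma mulv_subP A B C :
  reflect {in A & B, forall a b, saa_mul a b \in C} (mulv A B <= C)%VS.
Proof.
apply: (iffP span_subvP) => [sABC a b /coord_vbasis-> /coord_vbasis-> | sABC x].
  rewrite linear_sumr memv_suml // => j _; rewrite linearZr_LR memvZ //.
  rewrite linear_sumlz memv_suml // => i _; rewrite linearZl_LR memvZ //.
  by apply/sABC/allpairs_f; rewrite mem_nth ?size_tuple.
by case/allpairsP=> -[a b] /= [/vbasis_mem aA /vbasis_mem bB ->]; apply: sABC.
Qed.

Lemma centreP x : reflect (forall y, saa_mul x y = 0) (x \in centre).
Proof.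
have lin_ad : linear (fun x => linfun (saa_mul x) : 'Hom(L, L)).
  by move=> a u v; apply/lfunP=> y; rewrite add_lfunE scale_lfunE !lfunE /= linearPl.
pose ad : {linear L -> 'Hom(L, L)} :=
  HB.pack (fun x => linfun (saa_mul x) : 'Hom(L, L))
    (GRing.isLinear.Build F L 'Hom(L, L) *:%R _ lin_ad).
have adE : linfun (fun x => linfun (saa_mul x) : 'Hom(L, L)) x = linfun (saa_mul x).
  exact: (lfunE ad).
rewrite memv_ker adE; apply: (iffP eqP) => [x0 y | x0].
  by have /lfunP/(_ y) := x0; rewrite lfunE zero_lfunE.
by apply/lfunP=> y; rewrite lfunE zero_lfunE; apply: x0.
Qed.

End Structure.

(* Labels of the elements of a standard basis x_1, y_1, ..., x_n, y_n:
   [inl i] stands for x_(i+1) and [inr i] for y_(i+1), where i : 'I_n. *)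
Definition label n := ('I_n + 'I_n)%type.

Definition standard_basis (F : fieldType) (L : saa F) n (e : label n -> L) : Prop :=
  [/\ basis_of fullv [seq e u | u <- enum {: label n}],
      forall i j, saa_form (e (inl i)) (e (inl j)) = 0,
      forall i j, saa_form (e (inr i)) (e (inr j)) = 0
    & forall i j, saa_form (e (inl i)) (e (inr j)) = (i == j)%:R].

(* The entry (u, v, w, c) stands for the relation (uv, w) = c. *)
Definition presentation (F : fieldType) n := seq (label n * label n * label n * F).

Definition nilpotent_presentation (F : fieldType) n (P : presentation F n) : Prop :=
  forall u v w c, (u, v, w, c) \in P ->
  exists i j k : 'I_n,
    [/\ (i < j < k)%N, u = inl i \/ u = inr i, v = inr j & w = inr k].

(* Since (uv, w) is alternating in u, v, w, a listed triple determines exactly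
   the values at its rearrangements; all other values are 0. *)
Definition presented_by (F : fieldType) (L : saa F) n (P : presentation F n) : Prop :=
  exists e : label n -> L,
    [/\ standard_basis e,
        forall u v w c, (u, v, w, c) \in P -> saa_form (saa_mul (e u) (e v)) (e w) = c
      & forall u v w,
          (forall u' v' w' c, (u', v', w', c) \in P ->
             ~~ perm_eq [:: u; v; w] [:: u'; v'; w']) ->
          saa_form (saa_mul (e u) (e v)) (e w) = 0].

(* y_k with the 1-based index k, to be used for 1 <= k <= 5. *)
Definition y5 (k : nat) : label 5 := inr (inord k.-1).

Definition P10_5_1 (F : fieldType) : presentation F 5 :=
  [:: (y5 1, y5 2, y5 3, 1); (y5 1, y5 4, y5 5, 1)].

(* Main.v *)
Require Import Defs.
From HB Require Import structures.
From mathcomp Require Import all_boot all_algebra ring.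

(** Write T(x, y, z) for the alternating trilinear form (xy, z).  Its radical
    is the centre Z, so T lives on L / Z.  When dim L = 10 and Z is isotropic of
    dimension 5, Z is its own orthogonal, and L is recovered from the pair (L / Z, T):
    a Lagrangian complement of Z is identified with L / Z, the form pairs it with
    Z, and the product takes its values in Z.  Hence the classification is that
    of alternating trilinear forms without radical on a 5-dimensional space, and
    there is only one of them up to a change of basis.

    The normal form is reached by elimination ([exists_normal_frame]).  Take a,
    b, c with T(a, b, c) = 1 and project onto the common kernel of T(b, c, -),
    T(c, a, -) and T(a, b, -), which is a plane modulo Z.  For a basis d, e of it,
    T = a* b* c* + l d* e* (wedge products) with l a linear form in a*, b*, c*,
    nonzero because d is not in the radical.  A basis of <a, b, c> adapted to l
    turns this into y1* y2* y3* + y1* y4* y5*.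

    The vectors found are then lifted: Z contains a family dual to them, and
    correcting them by elements of Z, which T does not see, makes them span a
    Lagrangian subspace ([standard_basis_of_normal_frame]).  So every algebra of
    the theorem has the given presentation ([presented_by_P10_5_1]), and a
    presentation determines the algebra ([presented_by_unique]).  Existence is the
    construction above read backwards, on F^5 x F^5 ([model]); its products are
    central, which makes it nilpotent. *)

Set Implicit Arguments.
Unset Strict Implicit.
Unset Printing Implicit Defensive.

Import GRing.Theory.

(** * The trilinear form of a symplectic alternating algebra *)

Section TripleForm.
Local Open Scope ring_scope.
Variables (F : fieldType) (L : saa F).
Implicit Types (x y z w : L) (a : F).

Definition triple x y z : F := saa_form (saa_mul x y) z.

Lemma saa_formC x y : saa_form x y = - saa_form y x.
Proof.
apply/eqP; rewrite -addr_eq0; have := form_alt (x + y).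
by rewrite linearDl !linearDr /= !form_alt add0r addr0 => ->.
Qed.

Lemma saa_mulC x y : saa_mul x y = - saa_mul y x.
Proof.
apply/eqP; rewrite -addr_eq0; have := mul_alt (x + y).
by rewrite linearDl !linearDr /= !mul_alt add0r addr0 => ->.
Qed.

Lemma triple_rot x y z : triple x y z = triple y z x.
Proof. exact: form_mul. Qed.

Lemma triple_swap x y z : triple x y z = - triple y x z.
Proof. by rewrite /triple saa_mulC linearNl. Qed.

Lemma triple_alt x y : triple x x y = 0.
Proof. by rewrite /triple mul_alt linear0l. Qed.

Lemma triple_diag x y : (triple x x y = 0) * (triple x y x = 0) * (triple y x x = 0).
Proof.
split; [split|]; first exact: triple_alt.
- by rewrite -triple_rot triple_alt.
by rewrite triple_rot triple_alt.
Qed.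

(** Made for rewriting: one known value of the form gives those at all six
    rearrangements of its arguments. *)
Lemma triple_rearranged a x y z : triple x y z = a ->
  (triple x y z = a) * (triple y z x = a) * (triple z x y = a) *
  (triple y x z = - a) * (triple x z y = - a) * (triple z y x = - a).
Proof.
move=> <-.
split; last by rewrite triple_rot triple_swap.
split; last by rewrite -triple_rot triple_swap.
split; last by rewrite triple_swap.
split; last by rewrite triple_rot.
by split; last rewrite -triple_rot.
Qed.

Lemma triple_linear a x y z w :
  triple (a *: x + y) z w = a * triple x z w + triple y z w.
Proof. by rewrite /triple !linearPl. Qed.

Lemma triple_linear2 a x y z w :
  triple z (a *: x + y) w = a * triple z x w + triple z y w.
Proof. by rewrite triple_rot triple_linear (triple_rot z x) (triple_rot z y). Qed.

Lemma triple_linear3 a x y z w :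
  triple z w (a *: x + y) = a * triple z w x + triple z w y.
Proof. by rewrite -triple_rot triple_linear (triple_rot x) (triple_rot y). Qed.

Lemma centre_tripleP x : reflect (forall y z, triple x y z = 0) (x \in centre L).
Proof.
apply: (iffP (centreP x)) => [x0 y z | x0 y]; first by rewrite /triple x0 linear0l.
by apply: form_nondeg => z; apply: x0.
Qed.

End TripleForm.

(** * A presentation determines the algebra *)

Section Rearrangement.
Local Open Scope ring_scope.
Variables (F : fieldType) (I : eqType) (f g : I -> I -> I -> F).
Hypotheses (f_rot : forall u v w, f u v w = f v w u)
           (g_rot : forall u v w, g u v w = g v w u)
           (f_swap : forall u v w, f u v w = - f v u w)
           (g_swap : forall u v w, g u v w = - g v u w).

(** A rearrangement changes both sides by the same sign, so the sign need not be
    computed; with [g] zero this transports vanishing. *)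
Lemma skew_eq_perm u v w u' v' w' :
  perm_eq [:: u; v; w] [:: u'; v'; w'] ->
  f u' v' w' = g u' v' w' -> f u v w = g u v w.
Proof.
have f_swap23 a b c : f a c b = - f a b c by rewrite f_rot f_swap -f_rot.
have g_swap23 a b c : g a c b = - g a b c by rewrite g_rot g_swap -g_rot.
have fix1 u0 v0 w0 v1 w1 : perm_eq [:: u0; v0; w0] [:: u0; v1; w1] ->
    f u0 v1 w1 = g u0 v1 w1 -> f u0 v0 w0 = g u0 v0 w0.
  rewrite perm_cons => p01.
  have := perm_mem p01 v0; rewrite !inE eqxx /= => /esym/orP[] /eqP v0E.
    by move: p01; rewrite v0E perm_cons => /perm_small_eq -/(_ isT) [->].
  have: perm_eq [:: w0] [:: v1].
    rewrite -(perm_cons v0) (perm_trans p01) // v0E.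
    exact/permPl/(perm_catC [:: v1] [:: w1]).
  move=> /perm_small_eq -/(_ isT) [->] fg; rewrite v0E.
  by rewrite f_swap23 fg -g_swap23.
(* A rotation of the primed triple brings [u] to its front. *)
move=> p fg; have := perm_mem p u; rewrite !inE eqxx /= => /esym/or3P[] /eqP uE.
- by rewrite uE in p *; apply: fix1 p fg.
- rewrite uE in p *; apply: (fix1 _ _ _ w' u'); last by rewrite -f_rot -g_rot.
  by rewrite (perm_trans p) //; apply/permPl/(perm_catC [:: u'] [:: v'; w']).
rewrite uE in p *; apply: (fix1 _ _ _ u' v'); last by rewrite f_rot g_rot.
by rewrite (perm_trans p) //; apply/permPl/(perm_catC [:: u'; v'] [:: w']).
Qed.

End Rearrangement.

Section PresentationDeterminesAlgebra.
Local Open Scope ring_scope.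
Variable F : fieldType.

Lemma basis_ind (V : vectType F) (I : finType) (e : I -> V) (P : V -> Prop) :
  basis_of fullv [seq e u | u <- enum I] -> P 0 ->
  (forall a x y, P x -> P y -> P (a *: x + y)) -> (forall u, P (e u)) ->
  forall x, P x.
Proof.
move=> e_basis P0 P_lin Pe x.
have /coord_span-> : x \in <<in_tuple [seq e u | u <- enum I]>>%VS.
  by rewrite (span_basis e_basis) memvf.
apply: big_rec => // i y _; apply: P_lin.
have /mapP[u _ ->] : [seq e u | u <- enum I]`_i \in [seq e u | u <- enum I].
  by rewrite mem_nth.
exact: Pe.
Qed.

Lemma standard_form_eq (L M : saa F) n (e : label n -> L) (e' : label n -> M) :
  standard_basis e -> standard_basis e' ->
  forall u v, saa_form (e u) (e v) = saa_form (e' u) (e' v).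
Proof.
move=> [_ xx yy xy] [_ xx' yy' xy'] [i|i] [j|j]; rewrite ?xx ?yy ?xy ?xx' ?yy' ?xy' //.
by rewrite saa_formC xy saa_formC xy'.
Qed.

(** The linear map matching the bases preserves the form and the trilinear form;
    non-degeneracy then recovers the product from the trilinear form. *)
Lemma saa_isomorphic_of_bases (L M : saa F) n (e : label n -> L) (e' : label n -> M) :
  standard_basis e -> standard_basis e' ->
  (forall u v w, triple (e u) (e v) (e w) = triple (e' u) (e' v) (e' w)) ->
  saa_isomorphic L M.
Proof.
move=> std std' eqT; have eqB := standard_form_eq std std'.
have [b _ _ _] := std; have [b' _ _ _] := std'.
have [f f_map] := linear_of_free [seq e u | u <- enum {: label n}]
                                 [seq e' u | u <- enum {: label n}].
have [g g_map] := linear_of_free [seq e' u | u <- enum {: label n}]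
                                 [seq e u | u <- enum {: label n}].
have fE u : f (e u) = e' u.
  have := f_map (basis_free b); rewrite !size_map -map_comp => /(_ erefl)/eq_in_map.
  by apply; rewrite mem_enum.
have gE u : g (e' u) = e u.
  have := g_map (basis_free b'); rewrite !size_map -map_comp => /(_ erefl)/eq_in_map.
  by apply; rewrite mem_enum.
have fK : cancel f g.
  apply: (basis_ind b) => [|a x y IHx IHy|u]; first by rewrite !linear0.
    by rewrite !linearP IHx IHy.
  by rewrite fE gE.
have gK : cancel g f.
  apply: (basis_ind b') => [|a x y IHx IHy|u]; first by rewrite !linear0.
    by rewrite !linearP IHx IHy.
  by rewrite gE fE.
have f_form x y : saa_form (f x) (f y) = saa_form x y.
  move: x; apply: (basis_ind b) => [|a x1 x2 IH1 IH2|u].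
    by rewrite linear0 !linear0l.
    by rewrite linearP !linearPl IH1 IH2.
  move: y; apply: (basis_ind b) => [|a x1 x2 IH1 IH2|v].
    by rewrite linear0 !linear0r.
    by rewrite linearP !linearPr IH1 IH2.
  by rewrite !fE eqB.
have f_triple x y z : triple (f x) (f y) (f z) = triple x y z.
  move: x; apply: (basis_ind b) => [|a x1 x2 IH1 IH2|u].
  - by rewrite /triple linear0 !linear0l.
  - by rewrite linearP !triple_linear IH1 IH2.
  move: y; apply: (basis_ind b) => [|a x1 x2 IH1 IH2|v].
  - by rewrite /triple linear0 !linear0r !linear0l.
  - by rewrite linearP !triple_linear2 IH1 IH2.
  move: z; apply: (basis_ind b) => [|a x1 x2 IH1 IH2|w].
  - by rewrite /triple linear0 !linear0r.
  - by rewrite linearP !triple_linear3 IH1 IH2.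
  by rewrite !fE eqT.
exists f; split=> // [|x y]; first by exists g.
apply/eqP; rewrite -subr_eq0; apply/eqP/form_nondeg => z.
by rewrite linearBl -(gK z) f_form /= -/(triple (f x) (f y) _) f_triple subrr.
Qed.

(** Any triple of labels is a rearrangement of a listed one, whose value is given, or
    else has value 0. *)
Theorem presented_by_unique (L M : saa F) n (P : presentation F n) :
  presented_by L P -> presented_by M P -> saa_isomorphic L M.
Proof.
move=> [e [std listed unlisted]] [e' [std' listed' unlisted']].
apply: (saa_isomorphic_of_bases std std') => u v w.
have [/hasP[[[[u' v'] w'] c] in_P p]|no_p] :=
  boolP (has (fun r => perm_eq [:: u; v; w] [:: r.1.1.1; r.1.1.2; r.1.2]) P).
  pose f u1 u2 u3 := triple (e u1) (e u2) (e u3).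
  pose g u1 u2 u3 := triple (e' u1) (e' u2) (e' u3).
  apply: (@skew_eq_perm _ _ f g _ _ _ _ _ _ _ _ _ _ p) => [*|*|*|*|].
  - exact: triple_rot.
  - exact: triple_rot.
  - exact: triple_swap.
  - exact: triple_swap.
  by rewrite /f /g /triple (listed _ _ _ _ in_P) (listed' _ _ _ _ in_P).
have absent u' v' w' c : (u', v', w', c) \in P -> ~~ perm_eq [:: u; v; w] [:: u'; v'; w'].
  by move=> in_P; apply: contra no_p => p; apply/hasP; exists (u', v', w', c).
by rewrite /triple unlisted // unlisted'.
Qed.

End PresentationDeterminesAlgebra.

(** * Normal form of a trilinear form on a space of dimension 5 *)

Section NormalForm.
Local Open Scope ring_scope.
Variables (F : fieldType) (L : saa F).
Implicit Types (x y z w : L).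

Definition triple_row n (s : 'I_n -> L * L) x : 'rV[F]_n :=
  \row_j triple x (s j).1 (s j).2.

Fact triple_row_linear n (s : 'I_n -> L * L) : linear (triple_row s).
Proof. by move=> a x y; apply/rowP=> j; rewrite !mxE triple_linear. Qed.

HB.instance Definition _ n (s : 'I_n -> L * L) :=
  GRing.isLinear.Build F L 'rV[F]_n *:%R (triple_row s) (triple_row_linear s).

(** Rank counting without quotients: a family with a dual family of functionals of
    the form T(-, s1, s2) bounds the dimension of the centre, since all these
    functionals kill it.  It is applied to 3, 5 and 6 vectors. *)
Lemma dual_triples_kernel n (y : 'I_n -> L) (s : 'I_n -> L * L) :
  (forall i j, triple (y i) (s j).1 (s j).2 = (i == j)%:R) ->
  exists K : {vspace L},
    [/\ (\dim K + n = \dim {:L})%N, (centre L <= K)%VS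
      & forall x, x \in K <-> forall j, triple x (s j).1 (s j).2 = 0].
Proof.
move=> dual; exists (lker (linfun (triple_row s))).
have kerP x : reflect (forall j, triple x (s j).1 (s j).2 = 0)
                      (x \in lker (linfun (triple_row s))).
  rewrite memv_ker lfunE /=; apply: (iffP eqP) => [/rowP x0 j | x0].
    by have := x0 j; rewrite !mxE.
  by apply/rowP=> j; rewrite !mxE.
split; last by move=> x; split=> /kerP.
  have dim_img : \dim (limg (linfun (triple_row s))) = n.
    suff -> : limg (linfun (triple_row s)) = fullv by rewrite dimvf /dim /= mul1n.
    apply/eqP; rewrite eqEsubv subvf /=; apply/subvP=> v _.
    rewrite (row_sum_delta v) memv_suml // => i _; apply: memvZ.
    have -> : delta_mx 0 i = linfun (triple_row s) (y i).
      by apply/rowP=> j; rewrite lfunE !mxE dual eq_sym eqxx.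
    by rewrite memv_img ?memvf.
  by rewrite -(limg_ker_dim (linfun (triple_row s)) fullv) capfv dim_img.
by apply/subvP=> x /centre_tripleP x0; apply/kerP.
Qed.

Hypotheses (dimL : \dim {:L} = 10%N) (dimZ : \dim (centre L) = 5%N).

(** The trilinear form y0* y1* y2* + y0* y3* y4*, on the first five vectors of a
    sequence; increasing indices determine all other values. *)
Definition normal_frame (y : nat -> L) : Prop := forall i j k, (i < j < k)%N -> (k < 5)%N ->
  triple (y i) (y j) (y k) = ([:: i; j; k] \in [:: [:: 0; 1; 2]; [:: 0; 3; 4]]%N)%:R.

Definition perp a b c x : Prop :=
  [/\ triple a b x = 0, triple b c x = 0 & triple c a x = 0].

Lemma triple_scale3 x y z (t : F) : triple x y (t *: z) = t * triple x y z.
Proof. by rewrite -[t *: z]addr0 triple_linear3 /triple linear0r addr0. Qed.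

(** In dual coordinates, T = a* b* c* + (alpha a* + beta b* + gamma c* ) d* e* with
    alpha = T(a, d, e) nonzero, and similarly for beta and gamma.
    Rescaling e makes alpha equal to 1, and then b - beta a and c - gamma a lie in
    the kernel of the linear factor. *)
Lemma normal_frame_of_pair (a b c d e : L) :
  triple a b c = 1 -> perp a b c d -> perp a b c e ->
  triple a d e != 0 -> exists y : nat -> L, normal_frame y.
Proof.
move=> abc1 [abd bcd cad] [abe bce cae] ade.
pose t := (triple a d e)^-1.
pose b' := (- (t * triple b d e)) *: a + b.
pose c' := (- (t * triple c d e)) *: a + c.
exists (nth 0 [:: a; b'; c'; d; t *: e]).
move=> i j [|[|[|[|[|k]]]]] // /andP[] ltij; case: j ltij => [|[|[|[|j]]]] // + // _ _.
all: case: i => [|[|[|i]]] //= _.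
all: rewrite ?triple_scale3 /b' /c'.
all: rewrite ?triple_linear ?triple_linear2 ?triple_linear3 ?triple_diag.
all: rewrite ?(triple_rearranged abc1) ?(triple_rearranged bcd) ?(triple_rearranged cad)
  ?(triple_rearranged abd) ?(triple_rearranged bce) ?(triple_rearranged cae)
  ?(triple_rearranged abe) /t.
all: by field || ring.
Qed.

(** Centrality can be tested on a basis, so it is decidable and the witnesses
    exist constructively. *)
Lemma noncentral_triple x : x \notin centre L -> exists y z, triple x y z != 0.
Proof.
move=> xNZ; pose X := vbasis {:L}.
have X_basis : basis_of fullv [seq tnth X i | i <- enum 'I_(\dim {:L})].
  by rewrite map_tnth_enum vbasisP.
have [/existsP[i /existsP[j]]|] :=
  boolP [exists i, exists j, triple x (tnth X i) (tnth X j) != 0].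
  by exists (tnth X i), (tnth X j).
rewrite negb_exists => /forallP x0; case/negP: xNZ; apply/centre_tripleP => y z.
move: y; apply: (basis_ind X_basis) => [|t y1 y2 IH1 IH2|i].
- by rewrite /triple linear0r linear0l.
- by rewrite triple_linear2 IH1 IH2 mulr0 addr0.
move: z; apply: (basis_ind X_basis) => [|t z1 z2 IH1 IH2|j].
- by rewrite /triple linear0r.
- by rewrite triple_linear3 IH1 IH2 mulr0 addr0.
by have := x0 i; rewrite negb_exists => /forallP/(_ j); rewrite negbK => /eqP.
Qed.

Lemma perp_decomposition (a b c x : L) : triple a b c = 1 ->
  exists2 x', perp a b c x' & exists r s t, x = r *: a + (s *: b + (t *: c + x')).
Proof.
move=> abc1.
pose x' := x - (triple b c x *: a + (triple c a x *: b + triple a b x *: c)).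
exists x'; last first.
  exists (triple b c x), (triple c a x), (triple a b x).
  by rewrite addrA addrA -(addrA (_ *: a)) addrC subrK.
rewrite /x' -scaleN1r addrC; split.
all: rewrite triple_linear3 !triple_linear3 !triple_scale3 !triple_diag.
all: by rewrite ?(triple_rearranged abc1); ring.
Qed.

(** The vectors perpendicular to a, b, c form a subspace of codimension 3, hence of
    dimension 7, too large to be contained in the centre. *)
Lemma exists_noncentral_perp a b c : triple a b c = 1 ->
  exists2 p, perp a b c p & p \notin centre L.
Proof.
move=> abc1.
pose y (i : 'I_3) := [:: a; b; c]`_i.
pose s (i : 'I_3) := nth (0, 0) [:: (b, c); (c, a); (a, b)] i.
have dual i j : triple (y i) (s j).1 (s j).2 = (i == j)%:R.
  by case: i j => [[|[|[|i]]] //= ?] [[|[|[|j]]] //= ?]; rewrite /y /s /=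
    ?triple_diag ?(triple_rearranged abc1).
have [K [dimK _ kerP]] := dual_triples_kernel dual.
have /subvPn[p /kerP p_perp pNZ] : ~~ (K <= centre L)%VS.
  by apply/negP=> /dimvS; rewrite dimZ -(leq_add2r 3) dimK dimL.
exists p => //; split; rewrite -triple_rot.
- exact: (p_perp (Ordinal (isT : (2 < 3)%N))).
- exact: (p_perp (Ordinal (isT : (0 < 3)%N))).
exact: (p_perp (Ordinal (isT : (1 < 3)%N))).
Qed.

(** The six vectors would be independent modulo the centre, which has
    codimension 5. *)
Lemma no_two_disjoint_triples a b c p q r :
  triple a b c = 1 -> triple p q r = 1 ->
  perp a b c p -> perp a b c q -> perp a b c r ->
  perp p q r a -> perp p q r b -> perp p q r c -> False.
Proof.
have R (x y z : L) t := @triple_rearranged F L t x y z.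
move=> /R abc1 /R pqr1 [/R abp /R bcp /R cap] [/R abq /R bcq /R caq].
move=> [/R abr /R bcr /R car] [/R pqa /R qra /R rpa] [/R pqb /R qrb /R rpb].
move=> [/R pqc /R qrc /R rpc].
pose y (i : 'I_6) := [:: a; b; c; p; q; r]`_i.
pose s (i : 'I_6) := nth (0, 0) [:: (b, c); (c, a); (a, b); (q, r); (r, p); (p, q)] i.
have dual i j : triple (y i) (s j).1 (s j).2 = (i == j)%:R.
  by case: i j => [[|[|[|[|[|[|i]]]]]] //= ?] [[|[|[|[|[|[|j]]]]]] //= ?];
     rewrite /y /s /= ?triple_diag ?abc1 ?pqr1
             ?abp ?bcp ?cap ?abq ?bcq ?caq ?abr ?bcr ?car
             ?pqa ?qra ?rpa ?pqb ?qrb ?rpb ?pqc ?qrc ?rpc.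
have [K [dimK /dimvS leZK _]] := dual_triples_kernel dual.
by move: leZK; rewrite dimZ -(leq_add2r 6) dimK dimL.
Qed.

Lemma perp_rot a b c x : perp a b c x -> perp b c a x.
Proof. by case. Qed.

Lemma exists_normal_frame : exists y : nat -> L, normal_frame y.
Proof.
have /subvPn[x _ /noncentral_triple[y [z xyz]]] : ~~ ({:L} <= centre L)%VS.
  by apply/negP=> /dimvS; rewrite dimZ dimL.
pose a := x; pose b := y; pose c := (triple x y z)^-1 *: z.
have abc1 : triple a b c = 1 by rewrite triple_scale3 mulVf.
have bca1 : triple b c a = 1 by rewrite -triple_rot.
have cab1 : triple c a b = 1 by rewrite triple_rot.
have [p p_perp /noncentral_triple[v [w pvw]]] := exists_noncentral_perp abc1.
have [q q_perp [v1 [v2 [v3 vE]]]] := perp_decomposition v abc1.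
have [r r_perp [w1 [w2 [w3 wE]]]] := perp_decomposition w abc1.
(* By cyclic symmetry any of a, b, c may serve as the first vector of the pair lemma. *)
have found d e u : perp a b c d -> perp a b c e -> u \in [:: a; b; c] ->
    triple u d e != 0 -> exists y : nat -> L, normal_frame y.
  move=> d_perp e_perp; rewrite !inE => /or3P[] /eqP->.
  - by apply: normal_frame_of_pair abc1 _ _.
  - by apply: normal_frame_of_pair bca1 _ _; apply: perp_rot.
  by apply: normal_frame_of_pair cab1 _ _; do 2!apply: perp_rot.
have [/hasP[u uU /or3P[]]|] := boolP (has (fun u =>
    [|| triple u p q != 0, triple u q r != 0 | triple u r p != 0]) [:: a; b; c]).
- exact: found.
- exact: found.
- exact: found.
(* Otherwise T has no term mixing a, b, c with p, q, r, so T(p, v, w) is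
   T(p, q, r), and the six vectors are independent modulo the centre. *)
rewrite -all_predC => /allP mixed0.
have mixed u : u \in [:: a; b; c] -> perp p q r u.
  move=> /mixed0; rewrite /= !negb_or !negbK => /and3P[/eqP upq /eqP uqr /eqP urp].
  by split; rewrite -triple_rot.
have [[pqa qra rpa] [pqb qrb rpb] [pqc qrc rpc]] :
    [/\ perp p q r a, perp p q r b & perp p q r c].
  by split; apply: mixed; rewrite !inE eqxx ?orbT.
have pqr : triple p q r != 0.
  have R (x y z : L) t := @triple_rearranged F L t x y z.
  move: pvw p_perp q_perp r_perp => + [/R abp /R bcp /R cap] [_ _ _] [_ _ _].
  move: pqa pqb pqc rpa rpb rpc => /R pqa /R pqb /R pqc /R rpa /R rpb /R rpc.
  rewrite vE wE !(triple_linear2, triple_linear3) ?triple_diag.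
  rewrite ?abp ?bcp ?cap ?pqa ?pqb ?pqc ?rpa ?rpb ?rpc.
  by rewrite !(oppr0, mulr0, addr0, add0r).
pose r' := (triple p q r)^-1 *: r.
have pqr1 : triple p q r' = 1 by rewrite triple_scale3 mulVf.
have r'_perp : perp a b c r'.
  by case: r_perp => abr bcr car; split; rewrite triple_scale3 ?abr ?bcr ?car mulr0.
have r'_dual u : perp p q r u -> perp p q r' u.
  move=> [pqu qru rpu]; split=> //.
  - by rewrite -triple_rot triple_scale3 (triple_rot u) qru mulr0.
  by rewrite triple_rot triple_scale3 -(triple_rot r p u) rpu mulr0.
by case: (no_two_disjoint_triples abc1 pqr1); do ?apply: r'_dual.
Qed.

End NormalForm.

(** * From a normal frame to a standard basis *)

Section StandardBasis.
Local Open Scope ring_scope.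
Variables (F : fieldType) (L : saa F).
Implicit Types (x y z w : L).

Lemma standard_basis_of_form n (e : label n -> L) :
  \dim {:L} = (n + n)%N ->
  (forall i j, saa_form (e (inl i)) (e (inl j)) = 0) ->
  (forall i j, saa_form (e (inr i)) (e (inr j)) = 0) ->
  (forall i j, saa_form (e (inl i)) (e (inr j)) = (i == j)%:R) ->
  standard_basis e.
Proof.
move=> dimL xx yy xy; split=> //.
rewrite basisEfree subvf size_map -cardT card_sum card_ord dimL leqnn !andbT.
(* Independence follows from a dual family for the form. *)
pose dual (u : label n) := match u with inl i => e (inr i) | inr i => - e (inl i) end.
have dualE u v : saa_form (e u) (dual v) = (u == v)%:R.
  case: u v => [i|i] [j|j] /=; rewrite ?linearNr /= ?xx ?yy ?xy ?oppr0 //.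
  by rewrite -saa_formC xy eq_sym.
apply/(@freeP _ _ _ (map_tuple e (enum_tuple {: label n}))) => k k0 i.
have X_nth (j : 'I_#|{: label n}|) :
    (map_tuple e (enum_tuple {: label n}))`_j = e (enum_val j).
  by rewrite (nth_map (enum_val j)) -?cardT // -enum_val_nth.
have := linear0l saa_form (dual (enum_val i)); rewrite -k0 linear_sumlz (bigD1 i) //=.
rewrite big1 => [|j neq_ji].
  by rewrite X_nth linearZl_LR /= dualE eqxx mulr1 addr0.
by rewrite X_nth linearZl_LR /= dualE (inj_eq enum_val_inj) (negPf neq_ji) mulr0.
Qed.

Lemma triple_central z x y : z \in centre L ->
  (triple z x y = 0) * (triple x z y = 0) * (triple x y z = 0).
Proof.
move=> /centre_tripleP z0; have R := triple_rearranged (z0 x y).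
split; last by rewrite R.
by split; [rewrite R | rewrite R oppr0].
Qed.

Lemma triple_mod_centre x y z x' y' z' :
  x' \in centre L -> y' \in centre L -> z' \in centre L ->
  triple (x + x') (y + y') (z + z') = triple x y z.
Proof.
move=> x'Z y'Z z'Z; rewrite -[x]scale1r -[y]scale1r -[z]scale1r.
rewrite triple_linear triple_linear2 triple_linear3 !scale1r.
rewrite !(triple_central _ _ x'Z, triple_central _ _ y'Z, triple_central _ _ z'Z).
by rewrite !(mul1r, addr0).
Qed.

Definition form_row n (y : nat -> L) x : 'rV[F]_n := \row_(j < n) saa_form x (y j).

Fact form_row_linear n (y : nat -> L) : linear (@form_row n y).
Proof. by move=> a u v; apply/rowP=> j; rewrite !mxE linearPl. Qed.

HB.instance Definition _ n (y : nat -> L) :=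
  GRing.isLinear.Build F L 'rV[F]_n *:%R (@form_row n y) (form_row_linear n y).

Hypotheses (dimL : \dim {:L} = 10%N) (dimZ : \dim (centre L) = 5%N)
           (isoZ : isotropic (centre L)).

(** The frame has dual functionals of the form T(-, y_j, y_k), whose common kernel
    has dimension 5 and contains the centre, hence equals it. *)
Lemma normal_frame_spans (y : nat -> L) : normal_frame y -> forall v,
  exists c : 'I_5 -> F, v - \sum_i c i *: y i \in centre L.
Proof.
move=> y_nf v.
have R (x1 x2 x3 : L) t := @triple_rearranged F L t x1 x2 x3.
pose s (i : 'I_5) := nth (0, 0)
  [:: (y 1%N, y 2); (y 2, y 0%N); (y 0%N, y 1%N); (y 4, y 0%N); (y 0%N, y 3)] i.
have dual (i j : 'I_5) : triple (y i) (s j).1 (s j).2 = (i == j)%:R.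
  have /R y012 := y_nf 0%N 1%N 2 isT isT.
  have /R y013 := y_nf 0%N 1%N 3 isT isT.
  have /R y014 := y_nf 0%N 1%N 4 isT isT.
  have /R y023 := y_nf 0%N 2 3 isT isT.
  have /R y024 := y_nf 0%N 2 4 isT isT.
  have /R y034 := y_nf 0%N 3 4 isT isT.
  have /R y123 := y_nf 1%N 2 3 isT isT.
  have /R y124 := y_nf 1%N 2 4 isT isT.
  by case: i j => [[|[|[|[|[|i]]]]] //= ?] [[|[|[|[|[|j]]]]] //= ?];
     rewrite /s /= ?triple_diag ?y012 ?y013 ?y014 ?y023 ?y024 ?y034 ?y123 ?y124 ?oppr0.
have [K [dimK leZK kerP]] := dual_triples_kernel dual.
have -> : centre L = K.
  by apply/eqP; rewrite eqEdim leZK dimZ -(leq_add2r 5) dimK dimL.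
exists (fun i => triple v (s i).1 (s i).2); apply/kerP=> j.
rewrite /triple linearBl linear_sumlz linearBl linear_sumlz /= (bigD1 j) //=.
rewrite big1 => [|i neq_ij]; rewrite !linearZl_LR /= -/(triple (y _) _ _) dual.
  by rewrite eqxx mulr1 addr0 subrr.
by rewrite (negPf neq_ij) mulr0.
Qed.

(** A central vector orthogonal to the frame is orthogonal to everything, the centre
    being isotropic.  So pairing with the frame embeds the centre in F^5, and
    dimensions agree. *)
Lemma dual_central_frame (y : nat -> L) : normal_frame y -> exists x : 'I_5 -> L,
  forall i, x i \in centre L /\ forall j : 'I_5, saa_form (x i) (y j) = (i == j)%:R.
Proof.
move=> y_nf; pose h := linfun (@form_row 5 y).
have kerZ : (centre L :&: lker h)%VS = 0%VS.
  apply/eqP; rewrite -subv0; apply/subvP=> z; rewrite memv_cap memv_ker lfunE /= memv0.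
  move=> /andP[zZ /eqP/rowP z_y]; apply/eqP/form_nondeg => v.
  have [c vZ] := normal_frame_spans y_nf v.
  rewrite -(subrK (\sum_i c i *: y i) v) linearDr /= (isoZ zZ vZ) add0r.
  rewrite linear_sumr big1 // => i _.
  by rewrite linearZr_LR /=; have := z_y i; rewrite !mxE => ->; rewrite mulr0.
have imgZ : (h @: centre L)%VS = fullv.
  by apply/eqP; rewrite eqEdim subvf limg_dim_eq // dimZ dimvf.
have x_ex (i : 'I_5) : exists x,
    x \in centre L /\ forall j : 'I_5, saa_form x (y j) = (i == j)%:R.
  have /memv_imgP[x xZ hx] : delta_mx 0 i \in (h @: centre L)%VS by rewrite imgZ memvf.
  exists x; split=> // j.
  by move/rowP/(_ j): hx; rewrite lfunE !mxE eqxx /= eq_sym => ->.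
have /fin_all_exists[x xP] := x_ex.
by exists x.
Qed.

Lemma standard_basis_of_normal_frame (y : nat -> L) : normal_frame y ->
  exists e : label 5 -> L,
    [/\ standard_basis e, forall i, e (inl i) \in centre L
      & forall i : 'I_5, e (inr i) - y i \in centre L].
Proof.
move=> y_nf; have [x xP] := dual_central_frame y_nf.
have xZ i : x i \in centre L by case: (xP i).
have x_y (i j : 'I_5) : saa_form (x i) (y j) = (i == j)%:R by case: (xP i).
(* With y'_i = y_i + sum_k a_ik x_k one has (y'_i, y'_j) = (y_i, y_j) + a_ij - a_ji.
   A strictly upper triangular a cancels the Gram matrix in every characteristic. *)
pose a (i j : 'I_5) : F := if (i < j)%N then - saa_form (y i) (y j) else 0.
pose s i := \sum_j a i j *: x j.
have sZ i : s i \in centre L by apply: memv_suml => j _; apply: memvZ.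
have s_y i (j : 'I_5) : saa_form (s i) (y j) = a i j.
  rewrite linear_sumlz (bigD1 j) //= big1 => [|k neq_kj]; rewrite linearZl_LR /= x_y.
    by rewrite eqxx mulr1 addr0.
  by rewrite (negPf neq_kj) mulr0.
exists (fun u : label 5 => match u with inl i => x i | inr i => y i + s i end).
split=> // [|i]; last by rewrite addrAC subrr add0r.
apply: standard_basis_of_form => // i j; first exact: isoZ.
  rewrite linearDl !linearDr /= (isoZ (sZ i) (sZ j)) addr0 s_y.
  rewrite (saa_formC (y i) (s j)) s_y /a.
  case: ltngtP => [_|_|/ord_inj->].
  - by rewrite opprK addr0 saa_formC addNr.
  - by rewrite subr0 subrr.
  by rewrite form_alt subr0 addr0.
by rewrite linearDr /= x_y (isoZ (xZ i) (sZ j)) addr0.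
Qed.

Lemma sorted_triple (i j k : nat) : uniq [:: i; j; k] ->
  exists i' j' k', (i' < j' < k')%N /\ perm_eq [:: i; j; k] [:: i'; j'; k'].
Proof.
move=> ijk_uniq.
have p : perm_eq (sort leq [:: i; j; k]) [:: i; j; k] by rewrite perm_sort.
have := sort_sorted leq_total [:: i; j; k].
have := perm_size p; have := perm_uniq p; rewrite ijk_uniq => t_uniq t_size t_le.
have : sorted ltn (sort leq [:: i; j; k]) by rewrite ltn_sorted_uniq_leq t_uniq t_le.
case: (sort _ _) t_size p {t_uniq t_le} => [|i' [|j' [|k' []]]] // _ p.
by rewrite /= andbT => t_lt; exists i', j', k'; rewrite perm_sym.
Qed.

Lemma normal_frame_unlisted (y : nat -> L) (i j k : nat) : normal_frame y ->
  (i < 5)%N -> (j < 5)%N -> (k < 5)%N ->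
  ~~ perm_eq [:: i; j; k] [:: 0; 1; 2]%N -> ~~ perm_eq [:: i; j; k] [:: 0; 3; 4]%N ->
  triple (y i) (y j) (y k) = 0.
Proof.
move=> y_nf lti ltj ltk no012 no034.
have [/sorted_triple[i' [j' [k' [lt_ijk p]]]]|] := boolP (uniq [:: i; j; k]); last first.
  rewrite /= !inE !andbT negb_and negbK negbK.
  by move=> /orP[/orP[]|] /eqP->; rewrite triple_diag.
have ltk' : (k' < 5)%N.
  have : k' \in [:: i; j; k] by rewrite (perm_mem p) !inE eqxx !orbT.
  by rewrite !inE => /or3P[] /eqP->.
pose f i j k := triple (y i) (y j) (y k).
apply: (@skew_eq_perm _ _ f (fun _ _ _ => 0) _ _ _ _ _ _ _ _ _ _ p) => [*|*|*|*|] //.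
- exact: triple_rot.
- exact: triple_swap.
- by rewrite oppr0.
rewrite /f y_nf // inE; case: eqP => [eq|_]; first by rewrite eq (negPf no012) in p *.
by rewrite inE; case: eqP => // eq; rewrite eq (negPf no034) in p.
Qed.

Theorem presented_by_P10_5_1 : presented_by L (P10_5_1 F).
Proof.
have [y y_nf] := exists_normal_frame dimL dimZ.
have [e [e_std e_x e_y]] := standard_basis_of_normal_frame y_nf.
have e_triple (i j k : 'I_5) :
    triple (e (inr i)) (e (inr j)) (e (inr k)) = triple (y i) (y j) (y k).
  rewrite -(subrK (y i) (e (inr i))) -(subrK (y j) (e (inr j))) -(subrK (y k) (e (inr k))).
  by rewrite ![_ - _ + _]addrC triple_mod_centre.
exists e; split=> // [u v w c|u v w].
  rewrite !inE => /orP[] /eqP[-> -> -> ->]; rewrite -/(triple _ _ _) e_triple !inordK //.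
    exact: (y_nf 0%N 1%N 2).
  exact: (y_nf 0%N 3 4).
move=> unlisted; rewrite -/(triple _ _ _).
case: u v w unlisted => [i|i] [j|j] [k|k] unlisted;
  rewrite ?(triple_central _ _ (e_x _)) //.
rewrite e_triple; pose lab (m : nat) : label 5 := inr (inord m).
have labE (m : 'I_5) : inr m = lab m by rewrite /lab inord_val.
apply: normal_frame_unlisted => //.
  have := unlisted _ _ _ _ (mem_head _ _); rewrite !labE; apply: contra.
  exact: (@perm_map _ _ lab).
have := unlisted (y5 1) (y5 4) (y5 5) 1; rewrite !inE eqxx orbT => /(_ isT).
rewrite !labE; apply: contra; exact: (@perm_map _ _ lab).
Qed.

End StandardBasis.

(** * The model on F^5 x F^5 *)

Section CotangentModel.
Local Open Scope ring_scope.
Variable F : fieldType.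
Local Notation V := 'rV[F]_5.
Local Notation entry u k := (u 0 (inord k : 'I_5)).

(** The alternating form y2* y3* + y4* y5* on F^5 (with 0-based entries 1, ..., 4). *)
Definition sform2 (u v : V) : F :=
  entry u 1 * entry v 2 - entry u 2 * entry v 1
  + (entry u 3 * entry v 4 - entry u 4 * entry v 3).

(** The wedge product of y1* and [sform2], that is y1* y2* y3* + y1* y4* y5*. *)
Definition form3 (u v w : V) : F :=
  entry u 0 * sform2 v w + entry v 0 * sform2 w u + entry w 0 * sform2 u v.

Definition dot (a b : V) : F := \sum_k a 0 k * b 0 k.

(** The first factor of F^5 x F^5 is the dual of the second through [dot], and this
    vector represents the linear form [form3 u v]. *)
Definition form3_dual (u v : V) : V := \row_k form3 u v (delta_mx 0 k).

Definition model_form (p q : V * V) : F := dot p.1 q.2 - dot q.1 p.2.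

Definition model_mul (p q : V * V) : V * V := (form3_dual p.2 q.2, 0).

Lemma form3_linear w v : linear_for *%R (form3 ^~ v ^~ w).
Proof. by move=> a u u'; rewrite /form3 /sform2 !mxE; ring. Qed.

Lemma form3_cyclic u v w : form3 u v w = form3 v w u.
Proof. by rewrite /form3; ring. Qed.

Lemma form3_alt u w : form3 u u w = 0.
Proof. by rewrite /form3 /sform2; ring. Qed.

Lemma dot_linear b : linear_for *%R (dot ^~ b).
Proof.
move=> a u v; rewrite /dot mulr_sumr -big_split /=.
by apply: eq_bigr => k _; rewrite !mxE mulrDl mulrA.
Qed.

Lemma dotC a b : dot a b = dot b a.
Proof. by apply: eq_bigr => k _; rewrite mulrC. Qed.

Lemma dot_delta a k : dot a (delta_mx 0 k) = a 0 k.
Proof.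
rewrite /dot (bigD1 k) //= big1 => [|j neq_jk]; rewrite !mxE eqxx ?eqxx /=.
  by rewrite mulr1 addr0.
by rewrite (negPf neq_jk) mulr0.
Qed.

Lemma dot_form3_dual u v w : dot (form3_dual u v) w = form3 u v w.
Proof.
pose f w := form3 w u v.
have f_linear : linear_for *%R f by exact: form3_linear.
pose fL : {scalar V} := HB.pack f (GRing.isLinear.Build _ _ _ _ f f_linear).
rewrite form3_cyclic form3_cyclic -[RHS]/(fL w) [in RHS](row_sum_delta w) linear_sum.
by apply: eq_bigr => k _; rewrite linearZ /= mxE mulrC form3_cyclic form3_cyclic.
Qed.

Lemma dot0l b : dot 0 b = 0.
Proof. by rewrite /dot big1 // => k _; rewrite mxE mul0r. Qed.

Lemma dot0r a : dot a 0 = 0.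
Proof. by rewrite dotC dot0l. Qed.

Fact model_form_bilinear : bilinear_for *%R *%R model_form.
Proof.
split=> [q a p p' | p a q q']; rewrite /model_form /=.
  by rewrite dot_linear !(dotC q.1) dot_linear; ring.
by rewrite dot_linear !(dotC p.1) dot_linear; ring.
Qed.

HB.instance Definition _ := bilinear_isBilinear.Build F _ _ _ *%R *%R model_form
  model_form_bilinear.

Fact model_mul_bilinear : bilinear_for *:%R *:%R model_mul.
Proof.
split=> [q a p p' | p a q q']; congr pair; rewrite /= ?addr0 ?scaler0 //.
  by apply/rowP=> k; rewrite !mxE; apply: form3_linear.
by apply/rowP=> k; rewrite !mxE !(form3_cyclic p.2); apply: form3_linear.
Qed.

HB.instance Definition _ := bilinear_isBilinear.Build F _ _ _ *:%R *:%R model_mul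
  model_mul_bilinear.

Fact model_form_alt p : model_form p p = 0.
Proof. exact: subrr. Qed.

Fact model_form_nondeg p : (forall q, model_form p q = 0) -> p = 0.
Proof.
case: p => a u p0.
congr pair; apply/rowP=> k; rewrite mxE.
  by have := p0 (0, delta_mx 0 k); rewrite /model_form /= dot_delta dot0l subr0.
have := p0 (delta_mx 0 k, 0).
rewrite /model_form /= dot0r sub0r dotC dot_delta => /eqP.
by rewrite oppr_eq0 => /eqP.
Qed.

Fact model_mul_alt p : model_mul p p = 0.
Proof. by congr pair; apply/rowP=> k; rewrite !mxE form3_alt. Qed.

Fact model_form_mul p q r : model_form (model_mul p q) r = model_form (model_mul q r) p.
Proof.
by rewrite /model_form /model_mul /= !dot0r !subr0 !dot_form3_dual form3_cyclic.
Qed.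

Definition model : saa F :=
  @SAA F (V * V)%type model_form model_mul model_form_alt model_form_nondeg
       model_mul_alt model_form_mul.

(** Five pairs of basis vectors suffice: each entry of [u] is a value
    [form3 u v w]. *)
Lemma form3_nondeg u : (forall v w, form3 u v w = 0) -> u = 0.
Proof.
move=> u0; pose y k : V := delta_mx 0 (inord k).
have yE i j : (i < 5)%N -> (j < 5)%N -> entry (y i) j = (i == j)%:R.
  by move=> lti ltj; rewrite mxE eqxx -(inj_eq val_inj) /= !inordK // eq_sym.
have c0 := u0 (y 1%N) (y 2); have c1 := u0 (y 2) (y 0%N); have c2 := u0 (y 0%N) (y 1%N).
have c3 := u0 (y 4) (y 0%N); have c4 := u0 (y 0%N) (y 3).
apply/rowP=> k; rewrite mxE -(inord_val k).
case: k c0 c1 c2 c3 c4 => [[|[|[|[|[|k]]]]] //= _] c0 c1 c2 c3 c4.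
- by rewrite -[RHS]c0 /form3 /sform2 !yE //=; ring.
- by rewrite -[RHS]c1 /form3 /sform2 !yE //=; ring.
- by rewrite -[RHS]c2 /form3 /sform2 !yE //=; ring.
- by rewrite -[RHS]c3 /form3 /sform2 !yE //=; ring.
by rewrite -[RHS]c4 /form3 /sform2 !yE //=; ring.
Qed.

Lemma model_centreP (p : model) : p \in centre model <-> p.2 = 0.
Proof.
split=> [/centre_tripleP p0 | p0].
  apply: form3_nondeg => v w; have := p0 (0, v) (0, w).
  by rewrite /triple /= /model_form /= dot0l subr0 dot_form3_dual.
apply/centreP=> q; congr pair; apply/rowP=> k; rewrite !mxE p0.
by rewrite /form3 /sform2 !mxE; ring.
Qed.

Lemma model_dim : \dim {:model} = 10%N.
Proof. by rewrite dimvf. Qed.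

Lemma model_centre_isotropic : isotropic (centre model).
Proof.
move=> p q /model_centreP p0 /model_centreP q0.
by rewrite /saa_form /= /model_form p0 q0 !dot0r subrr.
Qed.

(** Products are central, so the third term of the series vanishes. *)
Lemma model_nilpotent : saa_nilpotent model.
Proof.
exists 3%N; apply/eqP; rewrite -subv0; apply/mulv_subP => x y x_lcs _.
suff /centreP-> : x \in centre model by rewrite mem0v.
apply: (subvP _) x x_lcs; apply/mulv_subP => a b _ _; exact/model_centreP.
Qed.

Lemma model_centre_dim : \dim (centre model) = 5%N.
Proof.
pose i (a : V) : V * V := (a, 0).
have i_linear : linear i by move=> t a b; congr pair; rewrite /= scaler0 addr0.
pose iL : {linear V -> model} := HB.pack i (GRing.isLinear.Build _ _ _ _ i i_linear).
have -> : centre model = limg (linfun iL).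
  apply/vspaceP=> p; apply/idP/idP => [/model_centreP p0 | /memv_imgP[a _ ->]].
    apply/memv_imgP; exists p.1; rewrite ?memvf // lfunE /=.
    by case: p p0 => a u /= ->.
  by apply/model_centreP; rewrite lfunE.
rewrite limg_dim_eq ?dimvf //; apply/eqP; rewrite -subv0; apply/subvP=> a.
by rewrite memv_cap memv_ker lfunE memv0 => /andP[_ /eqP[->]].
Qed.

End CotangentModel.

(** * Classification for an isotropic centre of dimension 5 *)

Lemma nilpotent_presentation_P10_5_1 (F : fieldType) :
  nilpotent_presentation (P10_5_1 F).
Proof.
move=> u v w c; rewrite !inE => /orP[] /eqP[-> -> -> _].
  exists (inord 0), (inord 1), (inord 2); split=> //; last by right.
  by rewrite !inordK.
exists (inord 0), (inord 3), (inord 4); split=> //; last by right.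
by rewrite !inordK.
Qed.

Theorem proposition3p1 (F : fieldType) :
  let good (L : saa F) :=
    [/\ saa_nilpotent L, \dim {:L} = 10%N, isotropic (centre L)
      & \dim (centre L) = 5%N] in
  nilpotent_presentation (P10_5_1 F) /\
  exists L : saa F,
    [/\ good L, forall M : saa F, good M -> saa_isomorphic L M
      & presented_by L (P10_5_1 F)].
Proof.
move=> good; split; first exact: nilpotent_presentation_P10_5_1.
have good_model : good (model F).
  split; [exact: model_nilpotent | exact: model_dim
         | exact: model_centre_isotropic | exact: model_centre_dim].
have presented L : good L -> presented_by L (P10_5_1 F).
  by move=> [_ dimL isoZ dimZ]; apply: presented_by_P10_5_1.
exists (model F); split=> [//|M good_M|]; last exact: presented.
exact: presented_by_unique (presented _ good_model) (presented _ good_M).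
Qed.
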